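(* Let $pod_2(n)$ be defined by $\sum_{n\ge 0} pod_2(n)q^n = \frac{\psi(-q^2)}{\psi(-q)} = \frac{f_2^2 f_8}{f_1 f_4^2}$, and let $T_k = k(k+1)/2$ denote the $k$-th triangular number. Then for every positive integer $n$, $$pod_2(3n+1)\equiv \begin{cases} 1 \pmod 2, & \text{if } n = 3T_k \text{ for some integer } k\ge 0,\\ 0 \pmod 2, & \text{otherwise.}\end{cases}$$
   Context: For $|q|<1$ and integers $j\ge 1$, $f_j := \prod_{n=1}^{\infty}(1-q^{jn})$. Ramanujan's theta function is $\psi(q) := \sum_{n=0}^{\infty} q^{n(n+1)/2} = f_2^2/f_1$, so that $\psi(-q) = f_1f_4/f_2$. The paper describes $pod_2(n)$ as the number of $2$-regular partitions of $n$ with distinct odd parts (even parts unrestricted), with generating function $\sum_{n\ge0} pod_2(n)q^n = \psi(-q^2)/\psi(-q)$. *)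

(* Defs.v *)
From HB Require Import structures.
From mathcomp Require Import all_boot all_order all_algebra.
From mathcomp Require Import boolp ring zify.

Set Implicit Arguments.
Unset Strict Implicit.
Unset Printing Implicit Defensive.

Import Order.TTheory GRing.Theory Num.Theory.
Local Open Scope ring_scope.

(* Formal power series in q with integer coefficients.  The type is a record,
   and not a plain arrow, to keep the Cauchy product apart from the pointwise
   ring structure on functions. *)
Record fps := Fps { fcoef :> nat -> int }.

Lemma fpsP (a b : fps) : (forall n, a n = b n) -> a = b.
Proof. by case: a b => [a] [b] /= ab; congr Fps; apply: funext. Qed.

HB.instance Definition _ := gen_eqMixin fps.
HB.instance Definition _ := gen_choiceMixin fps.

Section RingStructure.

Definition fps_zero := Fps (fun=> 0).
Definition fps_opp (a : fps) := Fps (fun n => - a n).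
Definition fps_add (a b : fps) := Fps (fun n => a n + b n).
Definition fps_one := Fps (fun n => (n == 0)%N%:R).
Definition fps_mul (a b : fps) := Fps (fun n => \sum_(i < n.+1) a i * b (n - i)%N).

Fact fps_addA : associative fps_add.
Proof. by move=> a b c; apply: fpsP => n /=; rewrite addrA. Qed.
Fact fps_addC : commutative fps_add.
Proof. by move=> a b; apply: fpsP => n /=; rewrite addrC. Qed.
Fact fps_add0 : left_id fps_zero fps_add.
Proof. by move=> a; apply: fpsP => n /=; rewrite add0r. Qed.
Fact fps_addN : left_inverse fps_zero fps_opp fps_add.
Proof. by move=> a; apply: fpsP => n /=; rewrite addNr. Qed.

HB.instance Definition _ :=
  GRing.isZmodule.Build fps fps_addA fps_addC fps_add0 fps_addN.

Definition fps_trunc N (a : fps) : {poly int} := \poly_(i < N) a i.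

Lemma coef_fps_trunc N (a : fps) n : (n < N)%N -> (fps_trunc N a)`_n = a n.
Proof. by move=> nN; rewrite coef_poly nN. Qed.

Lemma fps_mulE (N n : nat) (a b : fps) : (n < N)%N ->
  fps_mul a b n = (fps_trunc N a * fps_trunc N b)`_n.
Proof.
move=> nN; rewrite coefM /=; apply: eq_bigr => i _.
by have := ltn_ord i => ?; rewrite !coef_fps_trunc //; lia.
Qed.

Fact fps_mulA : associative fps_mul.
Proof.
move=> a b c; apply: fpsP => n.
pose t := fps_trunc n.+1.
have -> : fps_mul a (fps_mul b c) n = (t a * (t b * t c))`_n.
  change (\sum_(i < n.+1) a i * fps_mul b c (n - i)%N = (t a * (t b * t c))`_n).
  rewrite coefM; apply: eq_bigr => i _.
  by have := ltn_ord i => ?; rewrite (@fps_mulE n.+1) ?coef_fps_trunc //; lia.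
change ((t a * (t b * t c))`_n = \sum_(i < n.+1) fps_mul a b i * c (n - i)%N).
rewrite mulrA coefM; apply: eq_bigr => i _.
by have := ltn_ord i => ?; rewrite (@fps_mulE n.+1) ?coef_fps_trunc //; lia.
Qed.

Fact fps_mulC : commutative fps_mul.
Proof.
by move=> a b; apply: fpsP => n; rewrite !(@fps_mulE n.+1) // mulrC.
Qed.

Fact fps_mul1 : left_id fps_one fps_mul.
Proof.
move=> a; apply: fpsP => n /=.
rewrite big_ord_recl /= mul1r subn0 big1 ?addr0 // => i _.
by rewrite /= mul0r.
Qed.

Fact fps_mulDl : left_distributive fps_mul fps_add.
Proof.
move=> a b c; apply: fpsP => n /=; rewrite -big_split /=.
by apply: eq_bigr => i _; rewrite mulrDl.
Qed.

Fact fps_one_neq0 : fps_one != fps_zero.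
Proof. by apply/eqP => /(congr1 (fun a : fps => a 0%N)). Qed.

HB.instance Definition _ := GRing.Zmodule_isComNzRing.Build fps
  fps_mulA fps_mulC fps_mul1 fps_mulDl fps_one_neq0.

(* The first n coefficients of 1/a, from the recursion
   a_0 b_m = [m = 0] - sum_(i < m) a_(m - i) b_i. *)
Fixpoint fps_inv_seq (a : fps) (n : nat) : seq int :=
  if n is m.+1 then
    let s := fps_inv_seq a m in
    rcons s ((a 0%N)^-1 * ((m == 0)%N%:R - \sum_(i < m) a (m - i)%N * s`_i))
  else [::].

Definition fps_unit : {pred fps} := [pred a : fps | a 0%N \is a GRing.unit].
Definition fps_inv (a : fps) : fps :=
  if a \in fps_unit then Fps (fun n => (fps_inv_seq a n.+1)`_n) else a.

Lemma size_fps_inv_seq a n : size (fps_inv_seq a n) = n.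
Proof. by elim: n => //= n IHn; rewrite size_rcons IHn. Qed.

Lemma nth_fps_inv_seq a n m : (m < n)%N ->
  (fps_inv_seq a n)`_m = (fps_inv_seq a m.+1)`_m.
Proof.
elim: n => // n IHn; rewrite ltnS leq_eqVlt => /predU1P[-> //|mn].
by rewrite [LHS]/= nth_rcons size_fps_inv_seq mn IHn.
Qed.

Fact fps_mulV : {in fps_unit, left_inverse 1 fps_inv *%R}.
Proof.
move=> a ua; apply: fpsP => n; rewrite /fps_inv ua mulrC.
have u0 : a 0%N \is a GRing.unit by [].
change (\sum_(i < n.+1) a i * (fps_inv_seq a (n - i).+1)`_(n - i) =
        (n == 0)%N%:R).
rewrite (reindex_inj rev_ord_inj) /=.
under eq_bigr => i _.
  have -> : (n.+1 - i.+1 = n - i)%N by lia.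
  have -> : (n - (n - i) = i)%N by have := ltn_ord i; lia.
  over.
rewrite big_ord_recr /= subnn nth_rcons size_fps_inv_seq ltnn eqxx mulVKr //.
rewrite addrC -addrA -[RHS]addr0; congr (_ + _); apply/eqP.
rewrite addrC subr_eq0; apply/eqP; apply: eq_bigr => i _; congr (_ * _).
by rewrite nth_fps_inv_seq.
Qed.

Fact fps_unitPl (a b : fps) : b * a = 1 -> fps_unit a.
Proof.
move/(congr1 (fun c : fps => c 0%N)) => /=; rewrite big_ord1 subnn => ba.
by apply/unitrP; exists (b 0%N); split; rewrite // mulrC.
Qed.

Fact fps_inv_out : {in [predC fps_unit], fps_inv =1 id}.
Proof. by move=> a; rewrite inE /= /fps_inv => /negbTE ->. Qed.

HB.instance Definition _ := GRing.ComNzRing_hasMulInverse.Build fps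
  fps_mulV fps_unitPl fps_inv_out.

End RingStructure.

Definition q : fps := Fps (fun n => (n == 1)%N%:R).

(* a(g) = sum_k a_k g^k.  This is the usual substitution when g has zero
   constant term: g^k then has no term of degree n < k. *)
Definition fps_subst (a g : fps) : fps :=
  Fps (fun n => \sum_(k < n.+1) a k * (g ^+ k) n).

(* f_j = prod_(i >= 1) (1 - q^(j i)) for j >= 1: the factors with i > n do not
   contribute to the coefficient of q^n. *)
Definition f_ (j : nat) : fps :=
  Fps (fun n => (\prod_(1 <= i < n.+1) (1 - q ^+ (j * i)) : fps) n).

Definition tri (k : nat) : nat := (k * k.+1) %/ 2.

(* psi(q) = sum_(k >= 0) q^(tri k): as tri k >= k, the terms with k > n do not
   contribute to the coefficient of q^n. *)
Definition psi : fps :=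
  Fps (fun n => (\sum_(0 <= k < n.+1) q ^+ tri k : fps) n).

Definition pod2 (n : nat) : int :=
  (fps_subst psi (- q ^+ 2) / fps_subst psi (- q) : fps) n.

Section EtaQuotient.

Let eqm N (a b : fps) := forall n, (n < N)%N -> a n = b n.

Lemma fpsDE (a b : fps) n : (a + b) n = a n + b n. Proof. by []. Qed.
Lemma fpsNE (a : fps) n : (- a) n = - a n. Proof. by []. Qed.
Lemma fps0E n : (0 : fps) n = 0. Proof. by []. Qed.
Lemma fps1E n : (1 : fps) n = (n == 0)%N%:R. Proof. by []. Qed.
Lemma fpsME (a b : fps) n : (a * b) n = \sum_(i < n.+1) a i * b (n - i)%N.
Proof. by []. Qed.

Lemma fps_sumE I (r : seq I) (P : pred I) (F : I -> fps) n :
  (\sum_(i <- r | P i) F i) n = \sum_(i <- r | P i) F i n.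
Proof. exact: (big_morph (fun a : fps => a n)). Qed.

Lemma fpsM0E (a b : fps) : (a * b) 0%N = a 0%N * b 0%N.
Proof. by rewrite fpsME big_ord1. Qed.

Lemma fps_int (c : int) (a : fps) n : (c%:~R * a) n = c * a n.
Proof.
have natE m : (m%:R * a) n = m%:R * a n.
  elim: m => [|m IHm]; first by rewrite !mul0r.
  by rewrite -!natr1 !mulrDl fpsDE IHm !mul1r.
case: c => m; first by rewrite -pmulrn natE natz.
by rewrite NegzE mulrNz !mulNr fpsNE -pmulrn natE natz.
Qed.

Lemma eqm_trans N a b c : eqm N a b -> eqm N b c -> eqm N a c.
Proof. by move=> ab bc n nN; rewrite ab // bc. Qed.
Lemma eqm_sym N a b : eqm N a b -> eqm N b a.
Proof. by move=> ab n nN; rewrite ab. Qed.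
Lemma eqmD N a b c d : eqm N a b -> eqm N c d -> eqm N (a + c) (b + d).
Proof. by move=> ab cd n nN; rewrite !fpsDE ab // cd. Qed.
Lemma eqmM N a b c d : eqm N a b -> eqm N c d -> eqm N (a * c) (b * d).
Proof.
move=> ab cd n nN; rewrite !fpsME; apply: eq_bigr => i _.
by have := ltn_ord i => ?; rewrite ab ?cd //; lia.
Qed.
Lemma eqm_fps a b : (forall N, eqm N a b) -> a = b.
Proof. by move=> ab; apply: fpsP => n; apply: (ab n.+1). Qed.

Lemma fps_expr_small (g : fps) N : g 0%N = 0 -> eqm N (g ^+ N) 0.
Proof.
move=> g0; elim: N => // N IHN n nN; rewrite exprS fpsME fps0E.
apply: big1 => i _; have [->|i0] := eqVneq (i : nat) 0%N; first by rewrite g0 mul0r.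
by have := ltn_ord i => ?; rewrite IHN ?mulr0 //; lia.
Qed.

Lemma fps_qXE k n : (q ^+ k) n = (n == k)%N%:R.
Proof.
elim: k n => // k IHk n; rewrite exprS fpsME.
case: n => [|n]; first by rewrite big_ord1 /= mul0r.
rewrite big_ord_recl big_ord_recl /= !mul0r add0r mul1r big1 ?addr0.
  by rewrite subSS subn0 IHk eqSS.
by move=> i _; rewrite mul0r.
Qed.

Lemma fps_qXM_small k (a : fps) : eqm k (q ^+ k * a) 0.
Proof.
move=> n nk; rewrite -[0](mul0r a); apply: (@eqmM k) => // m mk.
exact: fps_expr_small.
Qed.

Lemma eqm_prod N M (g : fps) j : g 0%N = 0 -> (0 < j)%N -> (N <= M)%N ->
  eqm N (\prod_(1 <= i < M) (1 - g ^+ (j * i)))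
        (\prod_(1 <= i < N) (1 - g ^+ (j * i))).
Proof.
move=> g0 j0; elim: M => [|M IHM]; first by rewrite leqn0 => /eqP ->.
rewrite leq_eqVlt => /predU1P[<- //|NM].
case: M IHM NM => [|M] IHM NM; first by move=> ? ?; exfalso; lia.
rewrite big_nat_recr //=; apply: eqm_trans (IHM NM).
rewrite -[X in eqm _ _ X]mulr1; apply: eqmM => // n nN.
rewrite fpsDE fpsNE (@fps_expr_small g (j * M.+1)) ?subr0 //.
by have := leq_pmull M.+1 j0; lia.
Qed.

Lemma f_trunc N M j : (0 < j)%N -> (N <= M)%N ->
  eqm N (f_ j) (\prod_(1 <= i < M) (1 - q ^+ (j * i))).
Proof.
move=> j0 NM n nN /=; symmetry; apply: (@eqm_prod n.+1) => //.
exact: leq_trans NM.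
Qed.

Lemma tri_ge k : (k <= tri k)%N.
Proof. by rewrite /tri leq_divRL // mulnC; case: k => // k; nia. Qed.

Lemma psi_trunc N M : (N <= M)%N ->
  eqm N psi (\sum_(0 <= k < M) q ^+ tri k).
Proof.
move=> NM n nN /=; rewrite (@big_cat_nat _ _ _ n.+1 0%N M) //; last by lia.
rewrite [RHS]fpsDE [X in _ = _ + X]fps_sumE [X in _ = _ + X]big_nat_cond.
rewrite [X in _ = _ + X]big1 ?addr0 // => k.
rewrite andbT => /andP[nk _]; rewrite fps_qXE.
by have := tri_ge k; case: eqP => //; lia.
Qed.

Let o i : fps := 1 - q ^+ (2 * i).+1.
Let e i : fps := 1 - q ^+ (2 * i).+2.
Let P n : fps := \prod_(i < n) (e i / o i).

Lemma unit_1BqX k : (0 < k)%N -> 1 - q ^+ k \is a GRing.unit.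
Proof.
move=> k0; change ((1 - q ^+ k : fps) 0%N \is a GRing.unit).
by rewrite fpsDE fpsNE fps_qXE; case: k k0.
Qed.

Let uo i : o i \is a GRing.unit. Proof. exact: unit_1BqX. Qed.
Let ue i : e i \is a GRing.unit. Proof. exact: unit_1BqX. Qed.
Let uP n : P n \is a GRing.unit.
Proof.
rewrite /P; elim/big_rec: _ => [|i x _ ux]; first exact: unitr1.
by rewrite !unitrM ue unitrV uo.
Qed.

Let PS n : P n.+1 = P n * (e n / o n).
Proof. by rewrite /P big_ord_recr. Qed.

Lemma shanks_telescope n m :
  (\sum_(s < m) (P n.+1 / P s * q ^+ (s * (2 * n).+3)
                 - P n / P s * q ^+ (s * (2 * n).+1))) * o n
  = P n / P m * q ^+ (m * (2 * n).+1) * (1 - q ^+ (2 * m)).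
Proof.
elim: m => [|m IHm]; first by rewrite big_ord0 mul0r muln0 expr0 subrr mulr0.
rewrite big_ord_recr /= mulrDl {}IHm mulrBl.
have -> : P n.+1 / P m * q ^+ (m * (2 * n).+3) * o n
        = P n / P m * q ^+ (m * (2 * n).+3) * e n.
  rewrite PS -[P n * (e n / o n) / P m * _ * _]mulrA.
  rewrite (_ : P n * (e n / o n) / P m * (q ^+ (m * (2 * n).+3) * o n)
     = P n / P m * q ^+ (m * (2 * n).+3) * e n * ((o n)^-1 * o n)); last by ring.
  by rewrite mulVr // mulr1.
have -> : P n / P m.+1 * q ^+ (m.+1 * (2 * n).+1) * (1 - q ^+ (2 * m.+1))
        = P n / P m * q ^+ (m.+1 * (2 * n).+1) * o m.
  rewrite (_ : (2 * m.+1 = (2 * m).+2)%N); last by lia.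
  rewrite -/(e m) PS invrM ?uP //; last by rewrite unitrM unitrV ue uo.
  rewrite invrM ?unitrV ?ue ?uo // invrK.
  set x := q ^+ _; set y := (P m)^-1; set z := (e m)^-1.
  rewrite (_ : P n * (o m * z * y) * x * e m = P n * y * x * o m * (z * e m)).
    by rewrite mulVr // mulr1.
  by ring.
rewrite /o /e.
rewrite (_ : (m * (2 * n).+3 = m * (2 * n).+1 + 2 * m)%N); last by lia.
rewrite (_ : (m.+1 * (2 * n).+1 = m * (2 * n).+1 + 2 * n + 1)%N); last by lia.
rewrite -[(2 * n).+2]addn2 -[(2 * n).+1]addn1 -[(2 * m).+1]addn1 !exprD expr1.
by ring.
Qed.

(* Shanks's finite form of psi(q) = f_2^2 / f_1; modulo q^(2n + 1) only the term
   s = 0, which is P n, survives on the right. *)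
Lemma shanks n :
  \sum_(0 <= k < 2 * n) q ^+ tri k
  = \sum_(s < n) P n / P s * q ^+ (s * (2 * n).+1).
Proof.
elim: n => [|n IHn]; first by rewrite big_ord0 big_geq.
have t0 : tri (2 * n) = (n * (2 * n).+1)%N.
  by rewrite /tri -mulnA mulKn.
have t1 : tri (2 * n).+1 = (n.+1 * (2 * n).+1)%N.
  rewrite /tri (_ : ((2 * n).+1 * (2 * n).+2 = 2 * (n.+1 * (2 * n).+1))%N).
    by rewrite mulKn.
  by nia.
rewrite (_ : (2 * n.+1 = (2 * n).+2)%N); last by lia.
rewrite !big_nat_recr //= IHn t0 t1.
have := shanks_telescope n n.+1.
rewrite PS invrM ?uP //; last by rewrite unitrM unitrV ue uo.
rewrite (_ : (2 * n.+1 = (2 * n).+2)%N); last by lia.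
rewrite -/(e n) -PS invrM ?unitrV ?ue ?uo // invrK.
set x := q ^+ _; set y := \sum_(s < n.+1) _.
rewrite (_ : P n * (o n / e n / P n) * x * e n =
  x * o n * (P n / P n) * (e n / e n)); last by ring.
rewrite !divrr // !mulr1 => /(mulIr (uo n)).
rewrite /y sumrB => /(canRL (subrK _)) ->.
by rewrite big_ord_recr /= divrr // mul1r addrC addrA.
Qed.

Lemma gauss : psi * f_ 1 = f_ 2 ^+ 2.
Proof.
have prodE n F : \prod_(1 <= i < n.+1) F i = \prod_(i < n) F i.+1 :> fps.
  by rewrite big_add1 big_mkord.
apply: eqm_fps => N; pose n := N.+1.
have h1 : eqm N psi (P n).
  apply: eqm_trans (psi_trunc (_ : N <= 2 * n)%N) _; first by lia.
  rewrite shanks big_ord_recl /= mul0n expr0 /P big_ord0 invr1 !mulr1 -/(P n).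
  rewrite -[X in eqm _ _ X]addr0; apply: eqmD => // m mN.
  rewrite fps_sumE fps0E; apply: big1 => i _.
  rewrite mulrC fps_qXM_small //.
  by rewrite (leq_trans mN) // /bump /=; nia.
have h2 : eqm N (f_ 1) (\prod_(i < n) (o i * e i)).
  apply: eqm_trans (f_trunc (_ : 0 < 1)%N (_ : N <= (2 * n).+1)%N) _ => //.
    by lia.
  suff -> : \prod_(1 <= i < (2 * n).+1) (1 - q ^+ (1 * i)) =
            \prod_(i < n) (o i * e i) by [].
  elim: (n) => [|m IHm]; first by rewrite big_ord0 big_geq.
  rewrite (_ : (2 * m.+1 = (2 * m).+2)%N); last by lia.
  by rewrite big_ord_recr big_nat_recr // big_nat_recr //= IHm !mul1n mulrA.
have h3 : eqm N (f_ 2) (\prod_(i < n) e i).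
  apply: eqm_trans (f_trunc (_ : 0 < 2)%N (_ : N <= n.+1)%N) _ => //.
    by lia.
  rewrite prodE => m _; congr (fcoef _ m); apply: eq_bigr => i _.
  by rewrite /e mulnS.
apply: eqm_trans (eqmM h1 h2) _; rewrite expr2.
apply: eqm_trans (eqm_sym (eqmM h3 h3)).
rewrite /P -!big_split /= => m _; congr (fcoef _ m); apply: eq_bigr => i _.
by rewrite mulrA mulrVK.
Qed.

Section Subst.
Variables (g : fps) (g0 : g 0%N = 0).

Let ev (p : {poly int}) : fps := (map_poly intr p).[g].

Lemma subst_ev N (a : fps) : eqm N (fps_subst a g) (ev (fps_trunc N a)).
Proof.
move=> n nN; rewrite /ev (@horner_coef_wide _ N); last first.
  by rewrite (leq_trans (size_poly _ _)) // size_poly.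
rewrite fps_sumE -(big_mkord xpredT
  (fun i => ((map_poly intr (fps_trunc N a))`_i * g ^+ i : fps) n)).
rewrite (@big_cat_nat _ _ _ n.+1 0%N N) // [X in _ = _ + X]big_nat_cond.
rewrite [X in _ = _ + X]big1 ?addr0 ?big_mkord.
  apply: eq_bigr => i _; have := ltn_ord i => ?.
  by rewrite coef_map fps_int coef_fps_trunc //; lia.
move=> i; rewrite andbT => /andP[ni _].
by rewrite coef_map fps_int fps_expr_small ?mulr0.
Qed.

Lemma ev_small N (p : {poly int}) : (forall i, (i < N)%N -> p`_i = 0) -> eqm N (ev p) 0.
Proof.
move=> p0; rewrite -[p](poly_take_drop N).
have -> : take_poly N p = 0.
  by apply/polyP => i; rewrite coef_take_poly coef0; case: ifP => // /p0.
rewrite add0r /ev rmorphM /= map_polyXn hornerM hornerXn mulrC.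
rewrite -[0](mul0r (map_poly intr (drop_poly N p)).[g]).
by apply: eqmM => //; apply: fps_expr_small.
Qed.

Lemma substM a b : fps_subst (a * b) g = fps_subst a g * fps_subst b g.
Proof.
apply: eqm_fps => N; apply: eqm_trans (@subst_ev N _) _.
apply: eqm_trans (eqm_sym (eqmM (@subst_ev N a) (@subst_ev N b))).
rewrite -hornerM -rmorphM /=.
set p := fps_trunc N (a * b); set r := _ * _.
rewrite -[p](subrK r) /ev rmorphD hornerD -[X in eqm _ _ X]add0r.
apply: eqmD => //; apply: ev_small => i iN.
rewrite coefB coef_fps_trunc // -(fps_mulE a b iN).
by rewrite subrr.
Qed.

Lemma substD a b : fps_subst (a + b) g = fps_subst a g + fps_subst b g.
Proof.
apply: fpsP => n /=; rewrite -big_split /=.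
by apply: eq_bigr => i _; rewrite mulrDl.
Qed.

Lemma substN a : fps_subst (- a) g = - fps_subst a g.
Proof.
apply: fpsP => n /=; rewrite -sumrN.
by apply: eq_bigr => i _; rewrite mulNr.
Qed.

Lemma subst1 : fps_subst 1 g = 1.
Proof.
apply: fpsP => n; change (\sum_(k < n.+1) (1 : fps) k * (g ^+ k) n = (1 : fps) n).
rewrite big_ord_recl big1 => [|i _]; first by rewrite mul1r addr0.
by rewrite /= mul0r.
Qed.

Lemma substq : fps_subst q g = g.
Proof.
apply: fpsP => n /=; rewrite big_ord_recl /= mul0r add0r.
case: n => [|n]; first by rewrite big_ord0 g0.
by rewrite big_ord_recl /= mul1r big1 ?addr0 // => i _; rewrite mul0r.
Qed.

Lemma substX a n : fps_subst (a ^+ n) g = fps_subst a g ^+ n.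
Proof. by elim: n => [|n IHn]; rewrite ?subst1 // !exprS substM IHn. Qed.

Lemma subst_f N M j : (0 < j)%N -> (N <= M)%N ->
  eqm N (fps_subst (f_ j) g) (\prod_(1 <= i < M) (1 - g ^+ (j * i))).
Proof.
move=> j0 NM.
suff -> : \prod_(1 <= i < M) (1 - g ^+ (j * i))
        = fps_subst (\prod_(1 <= i < M) (1 - q ^+ (j * i))) g.
  move=> n nN; apply: eq_bigr => i _; congr (_ * _).
  by apply: (f_trunc j0 NM); have := ltn_ord i; lia.
rewrite (big_morph (fps_subst^~ g) substM subst1).
by apply: eq_bigr => i _; rewrite substD substN subst1 substX substq.
Qed.

End Subst.

Lemma psi_subst m : (0 < m)%N ->
  fps_subst psi (- q ^+ m) * f_ (2 * m) = f_ m * f_ (4 * m).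
Proof.
move=> m0; pose g := - q ^+ m.
have g0 : g 0%N = 0 by rewrite /g fpsNE fps_qXE; case: m m0 {g}.
have uf j : (0 < j)%N -> f_ j \is a GRing.unit.
  by move=> j0; change (f_ j 0%N \is a GRing.unit); rewrite /= big_geq.
have s2 : fps_subst (f_ 2) g = f_ (2 * m).
  apply: eqm_fps => N; apply: eqm_trans (subst_f g0 (_ : 0 < 2)%N (leqnn N)) _ => //.
  apply: eqm_trans (eqm_sym (f_trunc _ (leqnn N))); last by lia.
  move=> k _; congr (fcoef _ k); apply: eq_bigr => i _.
  by rewrite exprM sqrrN -!exprM mulnA [(m * 2)%N]mulnC.
have split2 n (F : nat -> fps) : \prod_(1 <= i < (2 * n).+1) F i =
    \prod_(i < n) (F (2 * i).+1 * F (2 * i).+2).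
  elim: n => [|n IHn]; first by rewrite big_ord0 big_geq.
  rewrite (_ : (2 * n.+1 = (2 * n).+2)%N); last by lia.
  by rewrite big_ord_recr big_nat_recr // big_nat_recr //= IHn mulrA.
have split1 n (F : nat -> fps) : \prod_(1 <= i < n.+1) F i = \prod_(i < n) F i.+1.
  by rewrite big_add1 big_mkord.
have s1 : fps_subst (f_ 1) g * f_ m * f_ (4 * m) = f_ (2 * m) ^+ 3.
  apply: eqm_fps => N; pose n := N.
  have NM : (N <= (2 * n).+1)%N by lia.
  have NM' : (N <= n.+1)%N by lia.
  have m2 : (0 < 2 * m)%N by lia.
  have m4 : (0 < 4 * m)%N by lia.
  have h2 := f_trunc m2 NM; have h2' := f_trunc m2 NM'.
  apply: eqm_trans (eqmM (eqmM (subst_f g0 (ltn0Sn 0) NM) (f_trunc m0 NM))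
                         (f_trunc m4 NM')) _.
  rewrite exprSr expr2.
  apply: eqm_trans (eqm_sym (eqmM (eqmM h2' h2') h2)).
  rewrite !split2 !split1 -!big_split /= => k _; congr (fcoef _ k).
  apply: eq_bigr => i _; rewrite !mul1n /g.
  have no : (- q ^+ m) ^+ (2 * i).+1 = - (q ^+ m) ^+ (2 * i).+1.
    by rewrite !exprS !exprM sqrrN mulNr.
  have ne : (- q ^+ m) ^+ (2 * i).+2 = (q ^+ m) ^+ (2 * i).+2.
    by rewrite exprS no mulrNN -exprS.
  rewrite {}no {}ne -!exprM; set y := q ^+ m; set z := y ^+ i.
  have E a b c : c = (m * (i * a + b))%N -> q ^+ c = z ^+ a * y ^+ b.
    by move=> ->; rewrite /z /y -!exprM -exprD; congr (_ ^+ _); nia.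
  rewrite (E 2 1 (m * (2 * i).+1)%N); last by nia.
  rewrite (E 2 2 (m * (2 * i).+2)%N); last by nia.
  rewrite (E 4 4 (4 * m * i.+1)%N); last by nia.
  rewrite (E 4 2 (2 * m * (2 * i).+1)%N); last by nia.
  rewrite (E 4 4 (2 * m * (2 * i).+2)%N); last by nia.
  rewrite (E 2 2 (2 * m * i.+1)%N); last by nia.
  by ring.
apply: (mulIr (uf (2 * m)%N _)); first by lia.
apply: (mulIr (uf (2 * m)%N _)); first by lia.
have := congr1 (fps_subst^~ g) gauss; rewrite /= (substM g0) (substX g0) s2 => h.
have -> : fps_subst psi (- q ^+ m) * f_ (2 * m) * f_ (2 * m) * f_ (2 * m)
        = fps_subst psi g * f_ (2 * m) ^+ 3 by rewrite /g; ring.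
rewrite -s1 !mulrA h; ring.
Qed.

Theorem pod2_gf_eta :
  fps_subst psi (- q ^+ 2) / fps_subst psi (- q)
  = f_ 2 ^+ 2 * f_ 8 / (f_ 1 * f_ 4 ^+ 2).
Proof.
have uf j : (0 < j)%N -> f_ j \is a GRing.unit.
  by move=> j0; change (f_ j 0%N \is a GRing.unit); rewrite /= big_geq.
have u m : (0 < m)%N -> fps_subst psi (- q ^+ m) =
    f_ m * f_ (4 * m) / f_ (2 * m).
  by move=> m0; rewrite -psi_subst // mulrK // uf //; lia.
have u1 := u 1%N isT; rewrite expr1 !muln1 in u1.
rewrite u1 u // !invrM ?unitrV ?unitrX ?unitrM ?uf // invrK.
rewrite (_ : 2 * 2 = 4)%N // (_ : 4 * 2 = 8)%N //.
by ring.
Qed.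

End EtaQuotient.

(* Main.v *)
Require Import Defs.
From mathcomp Require Import all_boot all_order all_algebra.
From mathcomp Require Import ring zify.

(** Modulo 2, [psi(-q) = psi(q)] and, by Frobenius, [psi(-q^2) = psi(q)^2], so
    the generating function of [pod2] is congruent to [psi(q)]: [pod2 m] is odd
    exactly when [m] is triangular.  Finally [tri j = 1] modulo 3 forces
    [j = 3 k + 1], and [tri (3 k + 1) = 9 tri k + 1]. *)

Set Implicit Arguments.
Unset Strict Implicit.
Unset Printing Implicit Defensive.

Import Order.TTheory GRing.Theory Num.Theory.

Section Mod2.
Local Open Scope ring_scope.

Definition even_fps (a : fps) := forall n, (2 %| a n)%Z.

Lemma even_fpsM a b : even_fps a -> even_fps (a * b).
Proof.
move=> ea n; rewrite fpsME.
by apply: rpred_sum => i _; apply: dvdz_mulr.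
Qed.

Lemma even_fpsB a b : even_fps a -> even_fps b -> even_fps (a - b).
Proof. by move=> ea eb n; rewrite fpsDE fpsNE rpredB. Qed.

(** Each cross product of the square occurs twice; [y] collects one copy of each. *)
Lemma sqr_sum_mod2 (R : comPzRingType) (I : Type) (r : seq I) (F : I -> R) :
  exists y, (\sum_(i <- r) F i) ^+ 2 = \sum_(i <- r) F i ^+ 2 + (y + y).
Proof.
elim: r => [|i r [y IHr]]; first by exists 0; rewrite !big_nil; ring.
by exists (y + F i * \sum_(j <- r) F j); rewrite !big_cons sqrrD IHr; ring.
Qed.

(** Compares one term of a substitution with its sign-free counterpart: [(-1) ^+ k] comes from
    expanding [(- q ^+ m) ^+ k], and [c] tests whether its exponent is the wanted one. *)
Lemma dvd2_sign k (x y : int) (c : bool) :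
  (2 %| x - y)%Z -> (2 %| x * (-1) ^+ k * c%:R - y * c%:R)%Z.
Proof. by rewrite -signr_odd; case: (odd k); case: c => /=; lia. Qed.

Lemma dvd2_sub_sqr (x : int) : (2 %| x - x ^+ 2)%Z.
Proof. by have := divz_eq x 2; have := @modz_ge0 x 2 isT; have := @ltz_pmod x 2 isT; nia. Qed.

Lemma expNqX m k n : ((- q ^+ m) ^+ k) n = (-1) ^+ k * (n == m * k)%N%:R.
Proof.
have -> : (- q ^+ m) ^+ k = ((-1) ^+ k)%:~R * q ^+ (m * k).
  by rewrite rmorph_sign exprM -exprMn mulN1r.
by rewrite fps_int fps_qXE.
Qed.

Lemma fps_substE (a g : fps) n :
  fps_subst a g n = \sum_(k < n.+1) a k * (g ^+ k) n.
Proof. by []. Qed.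

Lemma subst_oppq_mod2 (a : fps) : even_fps (fps_subst a (- q) - a).
Proof.
move=> n; rewrite fpsDE fpsNE.
have -> : a n = \sum_(k < n.+1) a k * (n == k)%N%:R.
  rewrite big_ord_recr /= eqxx mulr1 big1 ?add0r // => i _.
  by rewrite gtn_eqF // mulr0.
rewrite fps_substE -sumrB; apply: rpred_sum => k _.
by rewrite -[q]expr1 expNqX mul1n mulrA; apply: dvd2_sign; rewrite subrr.
Qed.

(** Frobenius leaves the squares [a k ^+ 2] at the exponents [2 * k], and [a k ^+ 2] has the parity
    of [a k]. *)
Lemma subst_oppq2_mod2 (a : fps) : even_fps (fps_subst a (- q ^+ 2) - a ^+ 2).
Proof.
move=> n; rewrite fpsDE fpsNE.
(* Truncating makes the sum finite, as [sqr_sum_mod2] requires; coefficient [n] of the square only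
   involves coefficients of [a] up to [n]. *)
pose s : fps := \sum_(k < n.+1) (a k)%:~R * q ^+ k.
have as_ i : (i < n.+1)%N -> a i = s i.
  move=> ilt; rewrite fps_sumE (bigD1 (Ordinal ilt)) // fps_int fps_qXE eqxx.
  rewrite mulr1 big1 => [|k ki]; first by rewrite /= addr0.
  rewrite fps_int fps_qXE.
  by rewrite (_ : (i == k) = false) ?mulr0 //; apply/eqP => ik; case/eqP: ki; apply/val_inj.
have -> : (a ^+ 2) n = (s ^+ 2) n.
  rewrite !expr2 !fpsME; apply: eq_bigr => i _.
  by have := ltn_ord i => ?; rewrite !as_ //; lia.
have [y ->] := sqr_sum_mod2 (index_enum 'I_n.+1)
  (fun k : 'I_n.+1 => (a k)%:~R * q ^+ k : fps).
rewrite !fpsDE opprD addrA fps_sumE rpredB //; last first.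
  by change (2 %| y n + y n)%Z; lia.
rewrite fps_substE -sumrB; apply: rpred_sum => k _.
rewrite expNqX exprMn -rmorphXn fps_int -exprM fps_qXE mulnC mulrA.
by apply: dvd2_sign; apply: dvd2_sub_sqr.
Qed.

Lemma tri_double k : (2 * tri k = k * k.+1)%N.
Proof. by rewrite /tri mulnC divnK // dvdn2 oddM /=; case: odd. Qed.

Lemma tri_inj : injective tri.
Proof. by move=> j k jk; have := tri_double j; have := tri_double k; rewrite jk; nia. Qed.

Lemma psi_tri k : psi (tri k) = 1.
Proof.
rewrite (@psi_trunc (tri k).+1 (tri k).+1) // fps_sumE big_mkord.
have klt : (k < (tri k).+1)%N by rewrite ltnS tri_ge.
(* Since [tri] is injective, only the term of index [k] contributes. *)
rewrite (bigD1 (Ordinal klt)) // fps_qXE eqxx big1 => [|j jk]; first by rewrite /= addr0.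
rewrite fps_qXE (_ : (tri k == tri j) = false) //.
by apply/eqP => /tri_inj kj; case/eqP: jk; apply/val_inj.
Qed.

Lemma psi_ntri n : ~ (exists k, n = tri k) -> psi n = 0.
Proof.
move=> nt; rewrite (@psi_trunc n.+1 n.+1) // fps_sumE big1 // => k _.
by rewrite fps_qXE; case: eqP => // nk; case: nt; exists k.
Qed.

Lemma pod2_mod2 n : (2 %| pod2 n - psi n)%Z.
Proof.
set A := fps_subst psi (- q); set B := fps_subst psi (- q ^+ 2).
have uA : A \is a GRing.unit.
  change (A 0%N \is a GRing.unit).
  by rewrite fps_substE big_ord1 expr0 (psi_tri 0) mulr1.
suff e : even_fps (B / A - psi) by exact: e.
(* The numerator is [B - A * psi], split into two differences known to be even. Dividing by [A]
   preserves evenness, because the inverse again has integer coefficients. *)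
have -> : B / A - psi = ((B - psi ^+ 2) - (A - psi) * psi) / A.
  by rewrite -[X in _ - X](mulrK uA); ring.
apply: even_fpsM; apply: even_fpsB; first exact: subst_oppq2_mod2.
exact/even_fpsM/subst_oppq_mod2.
Qed.

End Mod2.

Lemma tri_mod3_1 n : (exists j, 3 * n + 1 = tri j) <-> (exists k, n = 3 * tri k).
Proof.
split=> [[j jn]|[k ->]]; last first.
  by exists (3 * k + 1); have := tri_double k; have := tri_double (3 * k + 1); nia.
have tj := tri_double j; rewrite -jn in tj; exists (j %/ 3); have tk := tri_double (j %/ 3).
have := divn_eq j 3; have : j %% 3 < 3 by rewrite ltn_mod.
(* If [j] is 0 or 2 modulo 3, then 3 divides [j * j.+1], which equals [2 * (3 * n + 1)]: a
   contradiction. *)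
move: (j %/ 3) (j %% 3) tk => k [|[|[|r]]] tk // _ jE; rewrite jE in tj; nia.
Qed.

Theorem theorem1p2 (n : nat) (hn : 0 < n) :
  ((exists k : nat, n = 3 * tri k) -> (pod2 (3 * n + 1) = 1 %[mod 2])%Z) /\
  (~ (exists k : nat, n = 3 * tri k) -> (pod2 (3 * n + 1) = 0 %[mod 2])%Z).
Proof.
have := pod2_mod2 (3 * n + 1); rewrite -eqz_mod_dvd => /eqP ->.
split=> [/tri_mod3_1[j ->]|nk]; first by rewrite psi_tri.
by rewrite psi_ntri // => /tri_mod3_1.
Qed.
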